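(* Let $\mathscr{B}\subset\mathbb{N}\setminus\{1\}$ be primitive. If the characteristic function $\eta$ of the set $\mathcal{F}_{\mathscr{B}}$ of $\mathscr{B}$-free numbers is a Toeplitz sequence, then $\mathscr{B}$ is taut.
   Context: $\mathbb{N}=\{1,2,3,\ldots\}$. A set $\mathscr{B}\subset\mathbb{N}$ is primitive if for any $b,b'\in\mathscr{B}$, $b\mid b'$ implies $b=b'$. Put $\mathcal{M}_{\mathscr{B}}=\bigcup_{b\in\mathscr{B}}b\mathbb{Z}$ and $\mathcal{F}_{\mathscr{B}}=\mathbb{Z}\setminus\mathcal{M}_{\mathscr{B}}$; $\eta\in\{0,1\}^{\mathbb{Z}}$ satisfies $\eta(n)=1$ iff $n\in\mathcal{F}_{\mathscr{B}}$. A sequence $x\in\{0,1\}^{\mathbb{Z}}$ is a Toeplitz sequence if for every $n\in\mathbb{Z}$ there exists $s_n\in\mathbb{N}$ such that $x(n+ks_n)=x(n)$ for all $k\in\mathbb{Z}$. The density of $A$ is $d(A)=\lim_{N\to\infty}\frac1N|A\cap[1,N]|$ when the limit exists. A set $\mathscr{A}\subset\mathbb{N}\setminus\{1\}$ is Behrend if $d(\mathcal{M}_{\mathscr{A}})=1$ (i.e. the density exists and equals $1$). A set $\mathscr{B}$ is taut if it is primitive and does not contain any set of the form $c\mathscr{A}=\{ca: a\in\mathscr{A}\}$ with $c\in\mathbb{N}$ and $\mathscr{A}\subset\mathbb{N}\setminus\{1\}$ Behrend. *)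

(* Defs.v *)
From HB Require Import structures.
From mathcomp Require Import all_boot all_order all_algebra.
From mathcomp Require Import all_classical all_reals all_analysis.

Set Implicit Arguments.
Unset Strict Implicit.
Unset Printing Implicit Defensive.

Import Order.TTheory GRing.Theory Num.Theory.
Import numFieldNormedType.Exports.

Local Open Scope classical_set_scope.
Local Open Scope ring_scope.

(* Sets of positive integers are terms of type [set nat]; since [nat] contains
   0, positivity (or being greater than 1) is stated explicitly where needed. *)

Definition primitive (B : set nat) : Prop :=
  forall b b' : nat, B b -> B b' -> (b %| b')%N -> b = b'.

Definition multiples (B : set nat) : set int :=
  \bigcup_(b in B) [set z : int | (b%:Z %| z)%Z].

Definition free_numbers (B : set nat) : set int := ~` multiples B.

(* Two-sided 0-1 sequences are functions [int -> bool], with 1 = true. *)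
Definition eta (B : set nat) : int -> bool :=
  fun n => `[< free_numbers B n >].

Definition Toeplitz (x : int -> bool) : Prop :=
  forall n : int, exists2 s : nat, (0 < s)%N &
    forall k : int, x (n + k * s%:Z) = x n.

(* The cardinality of the intersection of A with [1, N]. *)
Definition count_upto (A : set int) (N : nat) : nat :=
  count (fun k : nat => `[< A k%:Z >]) (iota 1 N).

(* The density of A exists and equals d. *)
Definition has_density (R : realType) (A : set int) (d : R) : Prop :=
  (count_upto A N)%:R / N%:R @[N --> \oo] --> d.

Definition Behrend (R : realType) (A : set nat) : Prop :=
  A `<=` [set a | (1 < a)%N] /\ has_density (multiples A) (1 : R).

Definition taut (R : realType) (B : set nat) : Prop :=
  primitive B /\
  ~ exists (c : nat) (A : set nat),
      [/\ (0 < c)%N, Behrend R A & [set (c * a)%N | a in A] `<=` B].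

(* Main.v *)
Require Import Defs.
From mathcomp Require Import all_boot all_order all_algebra.
From mathcomp Require Import all_classical all_reals all_analysis.
From mathcomp Require Import zify.

Import Order.TTheory GRing.Theory Num.Theory.
Import numFieldNormedType.Exports.

(** Suppose [c * A] is contained in [B] with [A] Behrend. Primitivity makes [c]
    a [B]-free number, so the Toeplitz property gives a period [s] such that all
    [c + k c s = c (1 + k s)] are [B]-free. Hence the progression [1 + s Z]
    misses the multiples of [A], whose density is then at most [1 - 1 / s]. *)

Local Open Scope classical_set_scope.

(** Each of the [m] consecutive blocks of length [s] begins with a point where [P] fails. *)
Lemma count_iota_progression (P : pred nat) (s m : nat) :
  (0 < s)%N -> (forall k, ~~ P (1 + k * s)%N) ->
  (count P (iota 1 (m * s)) + m <= m * s)%N.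
Proof.
case: s => // s _ PN; elim: m => [|m IHm]; first by rewrite mul0n.
rewrite mulSn addnC [X in iota 1 X]addnC iotaD count_cat /= (negbTE (PN m)).
by have := count_size P (iota (1 + m * s.+1).+1 s); rewrite size_iota; lia.
Qed.

Lemma density_ne1_progression (R : realType) (S : set int) (s : nat) :
  (0 < s)%N -> (forall k : nat, ~ S (Posz (1 + k * s))) ->
  ~ has_density S (1 : R).
Proof.
(* At the cutoff [N.+1 * s], positive and at least [N], the ratio is at most [1 - 1 / s], which the
   strict tolerance [1 / s] forbids. *)
move=> s0 SN /cvgrPdist_lt /(_ (s%:R^-1)%R).
rewrite invr_gt0 ltr0n => /(_ s0) [N _ /(_ (N.+1 * s)%N)] /=.
have hN : (N <= N.+1 * s)%N by nia.
have hc : (count_upto S (N.+1 * s) + N.+1 <= N.+1 * s)%N.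
  by apply: count_iota_progression => // k; apply/asboolPn/SN.
move=> /(_ hN); apply/negP; rewrite -leNgt.
apply: le_trans (ler_norm _).
have sR : (0 < s%:R :> R)%R by rewrite ltr0n.
rewrite lerBrDr -lerBrDl ler_pdivrMr ?ltr0n ?muln_gt0 //.
move: hc; rewrite -(ler_nat R) natrD natrM -lerBrDr => /le_trans; apply.
by rewrite mulrBl mul1r mulrCA mulVf ?gt_eqF // mulr1.
Qed.

Lemma Toeplitz_progression (A B : set nat) (c : nat) :
  primitive B -> Toeplitz (eta B) -> (0 < c)%N ->
  A `<=` [set a | (1 < a)%N] -> [set (c * a)%N | a in A] `<=` B ->
  exists2 s, (0 < s)%N & forall k : nat, ~ multiples A (Posz (1 + k * s)).
Proof.
move=> primB toepB c0 A1 cAB.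
(* Freeness of [c] needs some [a0] in [A]; an empty [A] has no multiples, so any [s] works. *)
have [[a0 Aa0]|A0] := pselect (exists a, A a); last first.
  by exists 1%N => // k [a Aa _]; apply: A0; exists a.
have [s s0 per] := toepB (Posz c); exists s => // k [a Aa /= adiv].
(* A divisor [b] of [c] in [B] divides [c * a0], hence equals it, but [c * a0 > c]. *)
have etac : eta B (Posz c).
  apply/asboolP => -[b Bb /=]; rewrite dvdzE /= => bc.
  have eb : b = (c * a0)%N.
    by apply: primB; rewrite ?dvdn_mulr //; apply: cAB; exists a0.
  have := dvdn_leq c0 bc; have /= := A1 _ Aa0; rewrite eb; nia.
(* Shifting by [c * k] periods rather than [k] keeps the factor [c], so [c * a] divides the shifted
   point. *)
have := per (Posz (c * k)); rewrite etac => /asboolP; apply.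
exists (c * a)%N; first by apply: cAB; exists a.
move: adiv; rewrite /= -PoszM -PoszD !dvdzE /= => adiv.
by rewrite -mulnA -{2}[c]muln1 -mulnDr dvdn_mul.
Qed.

Theorem proposition5p4 (R : realType) (B : set nat)
    (B_gt1 : B `<=` [set b | (1 < b)%N]) (B_primitive : primitive B)
    (eta_Toeplitz : Toeplitz (eta B)) :
  taut R B.
Proof.
split=> // -[c [A [c0 [A1 densA] cAB]]].
have [s s0 sN] := Toeplitz_progression _ _ _ B_primitive eta_Toeplitz c0 A1 cAB.
exact: (density_ne1_progression _ _ _ s0 sN densA).
Qed.
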